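(* Let $x_0\in\mathcal U$ be a non-singular point of the system $\frac{dy}{dx}=A(x)y$. If there is a solver symmetry $Y\in\mathbf{sym}^1_X(\mathcal K)$, then the Galois group $\mathrm{Gal}(x_0,X)$ is conjugated (in $\mathrm{GL}(n,\mathbb C)$) to a subgroup of the triangular group (the group of invertible upper triangular $n\times n$ matrices).
   Context: Let $\mathcal U$ be a nonempty connected open subset of $\mathbb{CP}_1$ with affine coordinate $x$. A function field $\mathcal K$ is a subfield of the field of meromorphic functions on $\mathcal U$ that contains the constants $\mathbb C$ and is closed under $\frac{d}{dx}$; fix one. Fix $n\ge 1$ and $A(x)=(a_{ij}(x))\in\mathfrak{gl}(n,\mathcal K)$, and consider the linear system $\frac{dy}{dx}=A(x)y$, $y=(y_1,\ldots,y_n)$, with associated meromorphic vector field on $\mathcal U\times\mathbb C^n$ $$X=\frac{\partial}{\partial x}+\sum_{i,j=1}^n a_{ij}(x)y_j\frac{\partial}{\partial y_i}.$$ The singularities of the system are the poles of $A(x)$; the point at infinity (if in $\mathcal U$) counts as a singularity if the system rewritten in the coordinate $t=1/x$ has a pole at $t=0$. Linear symmetries: $\mathbf{sym}^1_X(\mathcal K)$ is the set of vector fields $Y=\sum_{i,j}b_{ij}(x)y_j\frac{\partial}{\partial y_i}$ with $b_{ij}\in\mathcal K$ and $[X,Y]=0$; equivalently the matrix $B(x)=(b_{ij}(x))$ of $Y$ satisfies $\frac{dB}{dx}=[A(x),B]$. The Jordan canonical form of such a $B(x)$ does not depend on the point $x$. $Y$ is a solver symmetry if all the eigenspaces of $B(x)$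 are one-dimensional (i.e. each eigenvalue has exactly one Jordan block). Galois group: for a finite-dimensional complex (algebraic) linear representation $\Psi:\mathrm{GL}(n,\mathbb C)\to\mathrm{GL}(E)$ with differential $\Psi':\mathfrak{gl}(n,\mathbb C)\to\mathrm{End}(E)$, the induced Lie--Vessiot system is $\frac{dv}{dx}=\Psi'(A(x))(v)$. A $\mathcal K$-rational solution is a solution $v(x)\in E\otimes_{\mathbb C}\mathcal K$. A $\mathcal K$-exponential pre-solution is an element $w(x)\in E\otimes_{\mathbb C}\mathcal K$ for which there is $b(x)\in\mathcal K$ with $\frac{dw}{dx}-\Psi'(A(x))(w)=-b(x)w$. For a non-singular point $x_0\in\mathcal U$, a matrix $\sigma\in\mathrm{GL}(n,\mathbb C)$ is Galoisian at $x_0$ if for every such representation $(E,\Psi)$: (a) $\Psi(\sigma)(v(x_0))=v(x_0)$ for every $\mathcal K$-rational solution $v(x)$ of the induced Lie--Vessiot system; (b) for every $\mathcal K$-exponential pre-solution $w(x)$ of the induced Lie--Vessiot system such that $w(x_0)$ is well defined, $\Psi(\sigma)(w(x_0))\in\mathbb C\,w(x_0)$. The Galoisian matrices at $x_0$ form the Galois group $\mathrm{Gal}(x_0,X)\subseteq\mathrm{GL}(n,\mathbb C)$. *)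

(* Defs.v *)
From HB Require Import structures.
From mathcomp Require Import all_boot all_order all_algebra.
From mathcomp Require Import complex.
From mathcomp Require Import all_classical all_reals all_analysis.
From mathcomp Require mpoly.
Set Implicit Arguments.
Unset Strict Implicit.
Unset Printing Implicit Defensive.
Import Order.TTheory GRing.Theory Num.Theory.
Import numFieldNormedType.Exports.
Local Open Scope classical_set_scope.
Local Open Scope ring_scope.

(* Naming the structure, and not just the carrier R[i], lets inference find
   the topology that numFieldNormedType puts on every numFieldType. *)
Definition Cx (R : realType) : numClosedFieldType := R[i].

(* [Some z] is the point with affine coordinate z, [None] the point at
   infinity; also the target of meromorphic functions, with [None] at poles. *)
Definition CP1 (R : realType) : topologicalType :=
  one_point_compactification (Cx R).

Definition fin (R : realType) (v : CP1 R) : Cx R := if v is Some z then z else 0.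

(* Local coordinate t centred at p: t = x - z at p = z, and t = 1/x at
   infinity. *)
Definition chart (R : realType) (p : CP1 R) (t : Cx R) : CP1 R :=
  match p with
  | Some z => Some (z + t)
  | None => if t == 0 then None else Some t^-1
  end.

(* Complex differentiable near each point with a finite value; the other
   points are isolated and are poles. Values outside U are irrelevant. *)
Definition meromorphic (R : realType) (U : set (CP1 R)) (f : CP1 R -> CP1 R) :=
  forall p, U p ->
    if f p is Some _ then
      \forall t \near (0 : Cx R), f (chart p t) <> None /\
        derivable (fun s : Cx R => fin (f (chart p s)) : Cx R) t 1
    else
      forall M : R, \forall t \near (0 : Cx R)^',
        f (chart p t) <> None /\ (M%:C)%C < `|fin (f (chart p t))|.

(* d/dx in the affine coordinate *)
Definition ddx (R : realType) (f : CP1 R -> CP1 R) (z : Cx R) : Cx R :=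
  derive1 (fun s : Cx R => fin (f (Some s)) : Cx R) z.

(* A subfield, containing the constants and closed under d/dx, of the field of
   meromorphic functions on U. A meromorphic function on a connected U is
   determined on U by its values off a discrete set, so each closure condition
   only constrains the result where the pointwise formula makes sense. *)
Record function_field (R : realType) (U : set (CP1 R))
    (K : set (CP1 R -> CP1 R)) : Prop := FunctionField {
  ff_meromorphic : forall f, K f -> meromorphic U f;
  ff_const : forall c : Cx R, exists2 h, K h & forall p, U p -> h p = Some c;
  ff_sub : forall f g, K f -> K g -> exists2 h, K h &
    forall p a b, U p -> f p = Some a -> g p = Some b -> h p = Some (a - b);
  ff_mul : forall f g, K f -> K g -> exists2 h, K h &
    forall p a b, U p -> f p = Some a -> g p = Some b -> h p = Some (a * b);
  ff_inv : forall f, K f -> (exists2 p, U p & f p <> Some 0) -> exists2 h, K h &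
    forall p a, U p -> f p = Some a -> a != 0 -> h p = Some a^-1;
  ff_ddx : forall f, K f -> exists2 h, K h &
    forall z, U (Some z) -> f (Some z) <> None -> h (Some z) = Some (ddx f z)
}.

Definition mx_over (R : realType) (K : set (CP1 R -> CP1 R)) (m n : nat)
    (M : 'M[CP1 R -> CP1 R]_(m, n)) := forall i j, K (M i j).

Definition finite_at (R : realType) (m n : nat)
    (M : 'M[CP1 R -> CP1 R]_(m, n)) (p : CP1 R) := forall i j, M i j p <> None.

(* The value M(p), meaningful when [finite_at M p]. *)
Definition evalmx (R : realType) (m n : nat) (M : 'M[CP1 R -> CP1 R]_(m, n))
    (p : CP1 R) : 'M[Cx R]_(m, n) := map_mx (fun f => fin (f p)) M.

Definition ddxmx (R : realType) (m n : nat) (M : 'M[CP1 R -> CP1 R]_(m, n))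
    (z : Cx R) : 'M[Cx R]_(m, n) := map_mx (fun f => ddx f z) M.

(* With t = 1/x the system y' = A y becomes dy/dt = - t^-2 A(1/t) y. *)
Definition nonsingular (R : realType) (n : nat) (A : 'M[CP1 R -> CP1 R]_n)
    (p : CP1 R) : Prop :=
  if p is Some _ then finite_at A p
  else forall i j, exists l : Cx R,
    (fun t : Cx R => - t ^- 2 * fin (A i j (chart None t)) : Cx R)
      @ (0 : Cx R)^' --> l.

(* Vector fields on (an open part of) C x C^n: the component along d/dx and
   the column of components along the d/dy_i. *)
Definition vfield (R : realType) (n : nat) :=
  Cx R -> 'cV[Cx R]_n -> Cx R * 'cV[Cx R]_n.

Definition along (R : realType) (n : nat) (g : Cx R -> 'cV[Cx R]_n -> Cx R)
    (xi : Cx R * 'cV[Cx R]_n) (z : Cx R) (y : 'cV[Cx R]_n) : Cx R :=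
  derive1 (fun s : Cx R => g (z + s * xi.1) (y + s *: xi.2) : Cx R) 0.

Definition lie_bracket (R : realType) (n : nat) (X Y : vfield R n) :
    vfield R n := fun z y =>
  (along (fun z y => (Y z y).1) (X z y) z y
     - along (fun z y => (X z y).1) (Y z y) z y,
   \col_i (along (fun z y => (Y z y).2 i 0) (X z y) z y
     - along (fun z y => (X z y).2 i 0) (Y z y) z y)).

(* d/dx + sum_ij a_ij(x) y_j d/dy_i *)
Definition system_field (R : realType) (n : nat) (A : 'M[CP1 R -> CP1 R]_n) :
    vfield R n := fun z y => (1, evalmx A (Some z) *m y).

(* sum_ij b_ij(x) y_j d/dy_i *)
Definition linear_field (R : realType) (n : nat) (B : 'M[CP1 R -> CP1 R]_n) :
    vfield R n := fun z y => (0, evalmx B (Some z) *m y).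

(* The elements of sym^1_X(K), given by their matrices. *)
Definition sym1 (R : realType) (U : set (CP1 R)) (K : set (CP1 R -> CP1 R))
    (n : nat) (A : 'M[CP1 R -> CP1 R]_n) : set 'M[CP1 R -> CP1 R]_n :=
  [set B | mx_over K B /\
    forall (z : Cx R) (y : 'cV[Cx R]_n), U (Some z) ->
      finite_at A (Some z) -> finite_at B (Some z) ->
      lie_bracket (system_field A) (linear_field B) z y = (0, 0)].

(* [eigenspace] consists of row vectors acted on from the right, hence the
   transpose. *)
Definition solver (R : realType) (U : set (CP1 R)) (n : nat)
    (A B : 'M[CP1 R -> CP1 R]_n) : Prop :=
  forall p, U p -> nonsingular A p -> forall c : Cx R,
    eigenvalue (evalmx B p)^T c -> \rank (eigenspace (evalmx B p)^T c) = 1%N.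

(* Algebraic representations GL(n) -> GL(m); the values of Psi at singular
   matrices are irrelevant. *)
Record alg_rep (R : realType) (n m : nat) (Psi : 'M[Cx R]_n -> 'M[Cx R]_m) :
    Prop := AlgRep {
  rep1 : Psi 1%:M = 1%:M;
  repM : forall g h, g \in unitmx -> h \in unitmx ->
    Psi (g *m h) = Psi g *m Psi h;
  rep_regular : forall k l, exists (P : mpoly.mpoly (n * n) (Cx R)) (N : nat),
    forall g, g \in unitmx ->
      Psi g k l = mpoly.meval (fun i => mxvec g 0 i) P / \det g ^+ N
}.

(* The differential of Psi at the identity. *)
Definition drep (R : realType) (n m : nat) (Psi : 'M[Cx R]_n -> 'M[Cx R]_m)
    (a : 'M[Cx R]_n) : 'M[Cx R]_m :=
  \matrix_(k, l) derive1 (fun s : Cx R => Psi (1%:M + s *: a) k l : Cx R) 0.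

Definition rational_solution (R : realType) (U : set (CP1 R))
    (K : set (CP1 R -> CP1 R)) (n m : nat) (A : 'M[CP1 R -> CP1 R]_n)
    (Psi : 'M[Cx R]_n -> 'M[Cx R]_m) (v : 'cV[CP1 R -> CP1 R]_m) : Prop :=
  mx_over K v /\
  forall z : Cx R, U (Some z) ->
    finite_at A (Some z) -> finite_at v (Some z) ->
    ddxmx v z = drep Psi (evalmx A (Some z)) *m evalmx v (Some z).

Definition exp_presolution (R : realType) (U : set (CP1 R))
    (K : set (CP1 R -> CP1 R)) (n m : nat) (A : 'M[CP1 R -> CP1 R]_n)
    (Psi : 'M[Cx R]_n -> 'M[Cx R]_m) (w : 'cV[CP1 R -> CP1 R]_m) : Prop :=
  mx_over K w /\
  exists2 b, K b & forall z : Cx R, U (Some z) ->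
    finite_at A (Some z) -> finite_at w (Some z) -> b (Some z) <> None ->
    ddxmx w z - drep Psi (evalmx A (Some z)) *m evalmx w (Some z)
      = - fin (b (Some z)) *: evalmx w (Some z).

Definition Gal (R : realType) (U : set (CP1 R)) (K : set (CP1 R -> CP1 R))
    (n : nat) (A : 'M[CP1 R -> CP1 R]_n) (x0 : CP1 R) : set 'M[Cx R]_n :=
  [set s | s \in unitmx /\
    forall (m : nat) (Psi : 'M[Cx R]_n -> 'M[Cx R]_m), alg_rep Psi ->
      (forall v, rational_solution U K A Psi v ->
         Psi s *m evalmx v x0 = evalmx v x0) /\
      (forall w, exp_presolution U K A Psi w -> finite_at w x0 ->
         exists c : Cx R, Psi s *m evalmx w x0 = c *: evalmx w x0)].

(* [is_trig_mx] means lower triangular. *)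
Definition triangular_group (R : realType) (n : nat) : set 'M[Cx R]_n :=
  [set g | g \in unitmx /\ is_trig_mx g^T].

Definition subgroup_of (R : realType) (n : nat) (G H : set 'M[Cx R]_n) : Prop :=
  [/\ H `<=` G, H 1%:M, forall g h, H g -> H h -> H (g *m h)
    & forall g, H g -> H (invmx g)].

Definition conj_set (R : realType) (n : nat) (P : 'M[Cx R]_n)
    (H : set 'M[Cx R]_n) : set 'M[Cx R]_n :=
  [set P *m s *m invmx P | s in H].

(* Main.v *)
Require Import Defs.
From HB Require Import structures.
From mathcomp Require Import all_boot all_order all_algebra.
From mathcomp Require Import complex.
From mathcomp Require Import all_classical all_reals all_analysis.
From mathcomp Require Import zify.
From mathcomp Require mpoly.
Import -(notations) mpoly.
Set Implicit Arguments.
Unset Strict Implicit.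
Unset Printing Implicit Defensive.
Import Order.TTheory GRing.Theory Num.Theory.
Import numFieldNormedType.Exports.
Local Open Scope classical_set_scope.
Local Open Scope ring_scope.

(** The matrix B of a linear symmetry satisfies B' = AB - BA, which says
    that B, read as a vector of size n^2, is a rational solution of the
    Lie-Vessiot system induced by the conjugation representation
    g |-> (M |-> g M g^-1), because the differential of that representation
    is a |-> (M |-> aM - Ma) ([sym1_rational_solution]).  A Galoisian matrix at
    x0 fixes the value of every rational solution, hence it commutes with
    M = B(x0) ([Gal_comm]).

    For a solver symmetry every eigenspace of M is a line, and the commutant of
    such a matrix is simultaneously triangularizable ([commutant_upper_trig]).
    Indeed, put M in triangular form with diagonal t_0, t_1, ..., and let p_i be
    the product of the X - t_k for k < i.  The kernel of p_i(M) contains the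
    i-th step of the invariant flag, and has dimension at most i because
    every factor has a kernel of dimension at most 1; so the steps of
    the flag are the kernels of the p_i(M), and these are stable under every
    matrix that commutes with M.

    Matrices of functions are evaluated with the value 0 at poles, both in the
    condition on rational solutions and in the condition on eigenspaces, so
    the argument applies verbatim at x0 without first showing that B is
    holomorphic there; it also covers the point at infinity. *)

(** * The commutant of a matrix whose eigenspaces are lines *)

Lemma rank_kermxM_le (F : fieldType) n (X Y : 'M[F]_n) :
  (\rank (kermx (X *m Y)) <= \rank (kermx X) + \rank (kermx Y))%N.
Proof.
rewrite !mxrank_ker leq_subLR.
have := mxrank_mul_min X Y; have := rank_leq_row X; have := rank_leq_row Y.
lia.
Qed.

Lemma rank_kermxpoly_prod_le (F : fieldType) n (T : 'M[F]_n.+1) (cs : seq F) :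
  (forall c, eigenvalue T c -> \rank (eigenspace T c) = 1%N) ->
  (\rank (kermxpoly T (\prod_(c <- cs) ('X - c%:P))) <= size cs)%N.
Proof.
move=> rk1; elim: cs => [|c cs IH]; first by rewrite big_nil kermxpoly1 mxrank0.
rewrite big_cons /kermxpoly rmorphM /=.
apply: leq_trans (rank_kermxM_le _ _) _.
rewrite -/(kermxpoly _ _) -eigenspace_poly; apply: (@leq_add _ _ 1 (size cs)) => //.
have [/rk1 -> //|] := boolP (eigenvalue T c).
by rewrite /eigenvalue negbK => /eqP ->; rewrite mxrank0.
Qed.

(** The characteristic polynomial of the leading i x i block when T is triangular.
    The index is a natural number, and [inord] makes sense of it for i <= n + 1. *)
Definition diag_poly (F : fieldType) n (T : 'M[F]_n.+1) (i : nat) : {poly F} :=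
  \prod_(c <- [seq T (inord k) (inord k) | k <- iota 0 i]) ('X - c%:P).

Lemma diag_polyS (F : fieldType) n (T : 'M[F]_n.+1) i :
  diag_poly T i.+1 = diag_poly T i * ('X - (T (inord i) (inord i))%:P).
Proof.
rewrite /diag_poly -[iota 0 i.+1]/(iota 0 (1 + i)) addnC iotaD.
by rewrite map_cat big_cat /= big_seq1.
Qed.

(** A Cayley-Hamilton argument on the leading block: T - t_i sends the i-th
    basis row into the span of the previous ones, which the other factors kill. *)
Lemma row_diag_poly (F : fieldType) n (T : 'M[F]_n.+1) (i : nat) (k : 'I_n.+1) :
  is_trig_mx T -> (k < i)%N -> row k (horner_mx T (diag_poly T i)) = 0.
Proof.
move=> /is_trig_mxP Ttrig; elim: i k => // i IH k.
rewrite ltnS leq_eqVlt => /orP[/eqP ki|ki]; rewrite diag_polyS; last first.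
  by rewrite rmorphM /= -mulmxE row_mul IH // mul0mx.
rewrite mulrC rmorphM /= -mulmxE row_mul -ki inord_val.
rewrite rmorphB /= horner_mx_X horner_mx_C.
rewrite mulmx_sum_row big1 // => l _; have [lk|kl] := ltnP l k.
  by rewrite -ki in IH; rewrite IH // scaler0.
rewrite !mxE; move: kl; rewrite leq_eqVlt => /orP[/eqP/val_inj <-|kl].
  by rewrite eqxx mulr1n subrr scale0r.
by rewrite Ttrig // -val_eqE (ltn_eqF kl) subrr scale0r.
Qed.

(** The reverse inclusion is [row_diag_poly], so a count of dimensions
    suffices; this is where the eigenspaces must be lines. *)
Lemma kermxpoly_diag_poly_sub (F : fieldType) n (T : 'M[F]_n.+1) i :
  is_trig_mx T ->
  (forall c, eigenvalue T c -> \rank (eigenspace T c) = 1%N) ->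
  (i <= n.+1)%N ->
  (kermxpoly T (diag_poly T i) <= (pid_mx i : 'M[F]_n.+1))%MS.
Proof.
move=> Ttrig rk1 lein.
have sub : ((pid_mx i : 'M[F]_n.+1) <= kermxpoly T (diag_poly T i))%MS.
  apply/row_subP => k; rewrite sub_kermx; apply/eqP.
  have [ki|ik] := ltnP k i; last first.
    suff -> : row k (pid_mx i : 'M[F]_n.+1) = 0 by rewrite mul0mx.
    by apply/rowP => l; rewrite !mxE [(_ < i)%N]ltnNge ik andbF.
  suff -> : row k (pid_mx i : 'M[F]_n.+1) = row k 1%:M.
    by rewrite -row_mul mul1mx row_diag_poly.
  by apply/rowP => l; rewrite !mxE ki andbT.
rewrite -(mxrank_leqif_sup sub) eqn_leq mxrankS //= rank_pid_mx //.
by apply: leq_trans (rank_kermxpoly_prod_le _ rk1) _; rewrite size_map size_iota.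
Qed.

(** S stabilizes the kernel of every polynomial in T, in particular the steps of
    the standard flag. *)
Lemma commutant_trig (F : fieldType) n (T S : 'M[F]_n) :
  is_trig_mx T ->
  (forall c, eigenvalue T c -> \rank (eigenspace T c) = 1%N) ->
  S *m T = T *m S -> is_trig_mx S.
Proof.
case: n => [|n] in T S * => [|Ttrig rk1 ST].
  by move=> _ _ _; apply/is_trig_mxP => -[].
apply/is_trig_mxP => k l kl.
have /submxP[D rowkS] : (row k S <= (pid_mx k.+1 : 'M[F]_n.+1))%MS.
  apply: submx_trans (kermxpoly_diag_poly_sub Ttrig rk1 (ltn_ord k)).
  rewrite sub_kermx; apply/eqP.
  have cS : S *m horner_mx T (diag_poly T k.+1) =
      horner_mx T (diag_poly T k.+1) *m S by exact: comm_mx_horner.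
  by rewrite -row_mul cS row_mul row_diag_poly // mul0mx.
have -> : S k l = row k S 0 l by rewrite mxE.
rewrite rowkS mxE big1 // => j _; rewrite mxE.
by case: eqP => [->|]; rewrite ?mulr0 // ltnNge kl mulr0.
Qed.

(** [is_trig_mx] and [eigenspace] refer to lower triangular matrices and row
    vectors; working with the transpose of M turns them into upper triangular
    matrices and column vectors. *)
Lemma commutant_upper_trig (C : numClosedFieldType) n (M : 'M[C]_n) :
  (forall c, eigenvalue M^T c -> \rank (eigenspace M^T c) = 1%N) ->
  exists2 P : 'M[C]_n, P \in unitmx &
    forall S, S *m M = M *m S -> is_trig_mx (P *m S *m invmx P)^T.
Proof.
case: n => [|n] in M * => rk1.
  exists 1%:M; first exact: unitmx1.
  by move=> S _; apply/is_trig_mxP => -[].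
have [Q /unitarymx_unit Qu Qtrig] := Schur M^T (ltn0Sn n).
have {Qtrig} Ttrig : is_trig_mx (Q *m M^T *m invmx Q).
  by rewrite -conjumx.
exists (invmx Q)^T; first by rewrite unitmx_tr unitmx_inv.
move=> S SM.
rewrite -trmx_inv invmxK !trmx_mul !trmxK mulmxA.
apply: commutant_trig Ttrig _ _ => [c|].
  (* Q maps the eigenspaces of the conjugated matrix into those of M^T. *)
  have eq : (eigenspace (Q *m M^T *m invmx Q) c *m Q <= eigenspace M^T c)%MS.
    apply/eigenspaceP.
    have /eigenspaceP := submx_refl (eigenspace (Q *m M^T *m invmx Q) c).
    move=> /(congr1 (mulmx^~ Q)); rewrite !mulmxA mulmxKV // => ->.
    by rewrite scalemxAl.
  rewrite /eigenvalue -mxrank_eq0 -lt0n => rkgt.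
  have rkQ W : \rank (W *m Q) = \rank (W : 'M[C]_n.+1).
    by rewrite mxrankMfree // row_free_unit.
  have := mxrankS eq; rewrite rkQ => rkle.
  apply/eqP; rewrite eqn_leq rkgt andbT (leq_trans rkle) // rk1 //.
  by rewrite /eigenvalue -mxrank_eq0 -lt0n (leq_trans rkgt).
rewrite !mulmxA !mulmxKV //; congr (_ *m _).
by rewrite -!mulmxA -!trmx_mul SM.
Qed.

(** * The conjugation representation *)

Lemma tr_lin_mxE (F : fieldType) m n (f : 'M[F]_m -> 'M[F]_n) i j k l :
  (lin_mx f)^T (mxvec_index i j) (mxvec_index k l) = f (delta_mx k l) i j.
Proof. by rewrite !mxE /= vec_mx_delta mxvecE. Qed.

Lemma mulmx_deltaE (F : fieldType) m n p (X : 'M[F]_(m, n)) k (l : 'I_p) i j :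
  (X *m delta_mx k l) i j = X i k * (j == l)%:R.
Proof.
rewrite mxE (bigD1 k) //= big1 => [|q qk].
  by rewrite !mxE !eqxx addr0.
by rewrite !mxE (negPf qk) mulr0.
Qed.

Lemma delta_mulmxE (F : fieldType) m n p (X : 'M[F]_(n, p)) (k : 'I_m) l i j :
  (delta_mx k l *m X) i j = (i == k)%:R * X l j.
Proof.
rewrite mxE (bigD1 l) //= big1 => [|q ql].
  by rewrite !mxE !eqxx andbT addr0.
by rewrite !mxE (negPf ql) andbF mul0r.
Qed.

(** The transpose is there because [lin_mx] acts on row vectors from the right,
    whereas representations act on columns.  The definition is locked to keep
    unification from unfolding matrix inverses. *)
HB.lock Definition Ad (F : fieldType) n (g : 'M[F]_n) : 'M[F]_(n * n) :=
  (lin_mx (mulmxr (invmx g) \o mulmx g))^T.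

Lemma Ad_mxvec (F : fieldType) n (g M : 'M[F]_n) :
  Ad g *m (mxvec M)^T = (mxvec (g *m M *m invmx g))^T.
Proof. by rewrite Ad.unlock -trmx_mul mul_vec_lin. Qed.

Lemma AdE (F : fieldType) n (g : 'M[F]_n) i j k l :
  Ad g (mxvec_index i j) (mxvec_index k l) = g i k * invmx g l j.
Proof.
rewrite Ad.unlock tr_lin_mxE /= mxE (bigD1 l) //= big1 => [|q ql].
  by rewrite mulmx_deltaE eqxx mulr1 addr0.
by rewrite mulmx_deltaE (negPf ql) mulr0 mul0r.
Qed.

Lemma mulmx_trmxvec_inj (F : fieldType) n (X Y : 'M[F]_(n * n)) :
  (forall M, X *m (mxvec M)^T = Y *m (mxvec M)^T) -> X = Y.
Proof.
move=> XY; apply/trmx_inj/row_matrixP => i; rewrite !rowE.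
by apply: trmx_inj; rewrite !trmx_mul !trmxK -(vec_mxK (delta_mx 0 i)).
Qed.

(** The entries of g M g^-1 are polynomial in g up to one factor 1 / det g, by the
    adjugate formula. *)
Lemma alg_rep_Ad (R : realType) n : alg_rep (@Ad (Cx R) n).
Proof.
split.
- apply: mulmx_trmxvec_inj => M.
  by rewrite Ad_mxvec invmx1 mulmx1 !mul1mx.
- move=> g h gu hu; apply: mulmx_trmxvec_inj => M.
  rewrite -mulmxA !Ad_mxvec.
  have -> : invmx (g *m h) = invmx h *m invmx g.
    have ghu : g *m h \in unitmx by rewrite unitmx_mul gu.
    by rewrite -[RHS](mulKmx ghu) (mulmxA _ _ (invmx g)) mulmxK // mulmxV // mulmx1.
  by rewrite !mulmxA.
move=> p q; case/mxvec_indexP: p => i j; case/mxvec_indexP: q => k l.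
(* The adjugate of the generic matrix provides the polynomials. *)
pose G : 'M[mpoly (n * n) (Cx R)]_n :=
  \matrix_(i, j) mpolyX (Cx R) (mnm1 (mxvec_index i j)).
have GE g : map_mx (meval (fun i => mxvec g 0 i)) G = g.
  by apply/matrixP => ? ?; rewrite !mxE mevalXU mxvecE.
exists (G i k * (\adj G) l j), 1%N => g gu.
rewrite AdE /invmx gu expr1 rmorphM /=.
have -> : meval (fun i => mxvec g 0 i) (G i k) = g i k.
  by rewrite -[in RHS](GE g) [RHS]mxE.
have -> : meval (fun i => mxvec g 0 i) ((\adj G) l j) = (\adj g) l j.
  by rewrite -[in RHS](GE g) -map_mx_adj [RHS]mxE.
by rewrite -mulrA; congr (_ * _); rewrite mxE mulrC.
Qed.

(** * The differential of the conjugation representation *)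

Lemma horner_derivable (C : numFieldType) (p : {poly C}) (x : C) :
  derivable (fun s : C => p.[s] : C) x 1.
Proof.
elim/poly_ind: p => [|p c IH].
  have -> : (fun s : C => (0 : {poly C}).[s]) = cst 0.
    by apply/funext => s; rewrite horner0.
  exact: derivable_cst.
have -> : (fun s : C => (p * 'X + c%:P).[s]) =
    ((fun s : C => p.[s] : C) * id + cst c)%R.
  by apply/funext => s; rewrite hornerMXaddC.
apply: derivableD; last exact: derivable_cst.
by apply: derivableM => //; exact: derivable_id.
Qed.

Lemma horner_continuous (C : numFieldType) (p : {poly C}) :
  continuous (fun s : C => p.[s] : C).
Proof.
move=> x; apply: differentiable_continuous.
exact/derivable1_diffP/horner_derivable.
Qed.

(** The family 1 + s a as a matrix with polynomial entries: its determinant and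
    adjugate are then polynomials, which gives the continuity of the inverse. *)
Definition pencil (C : numFieldType) n (a : 'M[C]_n) : 'M[{poly C}]_n :=
  1%:M + 'X *: map_mx polyC a.

Lemma map_pencil (C : numFieldType) n (a : 'M[C]_n) s :
  map_mx (horner_eval s) (pencil a) = 1%:M + s *: a.
Proof.
apply/matrixP => i j; rewrite !mxE /= /horner_eval !hornerE.
by congr (_ + _); case: eqP => _; rewrite !hornerE.
Qed.

Lemma det_pencil (C : numFieldType) n (a : 'M[C]_n) s :
  (\det (pencil a)).[s] = \det (1%:M + s *: a).
Proof. by rewrite -map_pencil det_map_mx. Qed.

Lemma adj_pencil (C : numFieldType) n (a : 'M[C]_n) s i j :
  (\adj (pencil a) i j).[s] = \adj (1%:M + s *: a) i j.
Proof. by rewrite -map_pencil -map_mx_adj [RHS]mxE. Qed.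

Lemma near_unitmx1D (C : numFieldType) n (a : 'M[C]_n) :
  \forall s \near (0 : C), 1%:M + s *: a \in unitmx.
Proof.
have /cvgr_neq0 : (\det (pencil a)).[s] @[s --> (0 : C)] --> (\det (pencil a)).[0].
  exact: horner_continuous.
rewrite det_pencil scale0r addr0 det1 => /(_ (oner_neq0 _)).
by apply: filterS => s; rewrite unitmxE unitfE det_pencil.
Qed.

Lemma invmx1D_cvg (C : numFieldType) n (a : 'M[C]_n) i j :
  (invmx (1%:M + s *: a) i j : C) @[s --> (0 : C)] --> ((1%:M : 'M[C]_n) i j : C).
Proof.
have -> : (1%:M : 'M[C]_n) i j = (\det (pencil a)).[0]^-1 * (\adj (pencil a) i j).[0].
  by rewrite det_pencil adj_pencil scale0r addr0 det1 adj1 invr1 mul1r.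
have near_eq : \forall s \near (0 : C),
    (\det (pencil a)).[s]^-1 * (\adj (pencil a) i j).[s] = invmx (1%:M + s *: a) i j.
  apply: filterS (near_unitmx1D a) => s u.
  by rewrite det_pencil adj_pencil /invmx u [RHS]mxE.
apply: cvg_trans (near_eq_cvg near_eq) _.
apply: cvgM; last exact: horner_continuous.
apply: cvgV; last exact: horner_continuous.
by rewrite det_pencil scale0r addr0 det1 oner_neq0.
Qed.

(** The identity (1 + s a)^-1 - 1 = - s a (1 + s a)^-1 reduces differentiability to
    continuity. *)
Lemma is_derive_invmx1D (C : numFieldType) n (a : 'M[C]_n) i j :
  is_derive (0 : C) 1 (fun s => invmx (1%:M + s *: a) i j : C) (- a i j).
Proof.
pose g s := invmx (1%:M + s *: a) i j.
suff q : h^-1 *: ((g \o shift 0) (h *: (1 : C)) - g 0) @[h --> (0 : C)^'] --> - a i j.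
  by apply: DeriveDef; [apply/cvg_ex; eexists; exact: q|exact/cvg_lim/q].
have -> : a i j = (a *m 1%:M) i j by rewrite mulmx1.
have near_eq : \forall s \near (0 : C)^',
    - (\sum_k a i k * invmx (1%:M + s *: a) k j) =
    s^-1 *: ((g \o shift 0) (s *: (1 : C)) - g 0).
  near=> s.
  have u : 1%:M + s *: a \in unitmx.
    by near: s; apply: cvg_within; exact: near_unitmx1D.
  have s0 : s != 0 by near: s; exact: nbhs_dnbhs_neq.
  rewrite /g /= [s *: 1]mulr1 addr0 scale0r addr0 invmx1.
  apply: (scalerI s0); rewrite scalerA mulfV // scale1r.
  have /matrixP/(_ i j) := mulmxV u.
  rewrite mulmxDl mul1mx -scalemxAl !mxE => <-.
  by rewrite opprD addrA subrr add0r scalerN.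
apply: cvg_trans (near_eq_cvg near_eq) _.
apply: cvgN; rewrite mxE; apply: cvg_big => [|k _]; first exact: add_continuous.
apply: cvgM; first exact: cvg_cst.
by apply: cvg_within_filter; exact: invmx1D_cvg.
Unshelve. all: by end_near. Qed.

Lemma is_derive_affine (C : numFieldType) (b c : C) :
  is_derive (0 : C) 1 (fun s => b + s * c : C) c.
Proof.
have -> : (fun s => b + s * c) = cst b + (c \*: id).
  by apply/funext => s; rewrite /= mulrC.
by apply: is_derive_eq; rewrite add0r [_ *: 1]mulr1.
Qed.

Lemma is_derive_Ad (C : numFieldType) n (a : 'M[C]_n) i j k l :
  is_derive (0 : C) 1
    (fun s => Ad (1%:M + s *: a) (mxvec_index i j) (mxvec_index k l) : C)
    (a i k * (j == l)%:R - (i == k)%:R * a l j).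
Proof.
have -> : (fun s => Ad (1%:M + s *: a) (mxvec_index i j) (mxvec_index k l)) =
    (fun s => (i == k)%:R + s * a i k) * (fun s => invmx (1%:M + s *: a) l j).
  by apply/funext => s; rewrite AdE !mxE.
have := is_deriveM (is_derive_affine (i == k)%:R (a i k)) (is_derive_invmx1D a l j).
congr is_derive.
rewrite mul0r addr0 scale0r addr0 invmx1 mxE [l == j]eq_sym addrC scalerN.
by congr (_ - _); rewrite mulrC.
Qed.

Lemma drep_Ad_mxvec (R : realType) n (a M : 'M[Cx R]_n) :
  drep (@Ad (Cx R) n) a *m (mxvec M)^T = (mxvec (a *m M - M *m a))^T.
Proof.
pose ad : 'M[Cx R]_n -> 'M[Cx R]_n := mulmx a \- mulmxr a.
have -> : drep (@Ad (Cx R) n) a = (lin_mx ad)^T.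
  apply/matrixP => p q; case/mxvec_indexP: p => i j; case/mxvec_indexP: q => k l.
  rewrite tr_lin_mxE /ad /= [RHS]mxE [X in _ = _ + X]mxE mulmx_deltaE delta_mulmxE mxE.
  by rewrite derive1E; apply: (@derive_val _ _ _ _ _ _ _ (is_derive_Ad a i j k l)).
by rewrite -trmx_mul mul_vec_lin.
Qed.

(** * Linear symmetries as rational solutions *)

Lemma is_derive_mulmx (C : numFieldType) m n (M : C -> 'M[C]_(m, n)) (D : 'M[C]_(m, n))
    (y w : 'cV[C]_n) i :
  (forall j, is_derive (0 : C) 1 (fun s => M s i j : C) (D i j)) ->
  is_derive (0 : C) 1 (fun s => (M s *m (y + s *: w)) i 0 : C)
    ((D *m y + M 0 *m w) i 0).
Proof.
move=> dM.
have -> : (fun s => (M s *m (y + s *: w)) i 0 : C) =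
    \sum_j (fun s => M s i j : C) * (fun s => y j 0 + s * w j 0).
  apply/funext => s; rewrite mxE fct_sumE; apply: eq_bigr => j _.
  by rewrite !mxE.
have := is_derive_sum (fun j => is_deriveM (dM j) (is_derive_affine (y j 0) (w j 0))).
congr is_derive; rewrite !mxE -big_split; apply: eq_bigr => j _ /=.
by rewrite mul0r addr0 addrC; congr (_ + _); rewrite mulrC.
Qed.

Lemma is_derive_ddx (R : realType) (U : set (CP1 R)) (f : CP1 R -> CP1 R) z :
  meromorphic U f -> U (Some z) -> f (Some z) <> None ->
  is_derive (0 : Cx R) 1 (fun s => fin (f (Some (z + s))) : Cx R) (ddx f z).
Proof.
move=> fmer Uz fz; have := fmer _ Uz.
case E : (f (Some z)) => [c|//] /nbhs_singleton[_ df].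
apply: DeriveDef; first exact: df.
rewrite /ddx /derive1 /derive.
set d := (fun _ : Cx R => _); set d' := (fun _ : Cx R => _).
suff -> : d = d' by [].
apply/funext => h; rewrite /d /d' /= [h *: 1]mulr1. by rewrite !addr0 [z + h]addrC.
Qed.

(** The component of [X, Y] along the y_i is (B' + BA - AB) y, the first two terms
    being the derivative of B y along X and the last that of A y along Y. *)
Lemma sym1_ddxmx (R : realType) (U : set (CP1 R)) (K : set (CP1 R -> CP1 R))
    n (A B : 'M[CP1 R -> CP1 R]_n) z :
  (forall f, K f -> meromorphic U f) -> sym1 U K A B ->
  U (Some z) -> finite_at A (Some z) -> finite_at B (Some z) ->
  ddxmx B z = evalmx A (Some z) *m evalmx B (Some z)
              - evalmx B (Some z) *m evalmx A (Some z).
Proof.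
move=> Kmer [KB bracket0] Uz Az Bz.
suff E (y : 'cV_n) : ddxmx B z *m y + evalmx B (Some z) *m (evalmx A (Some z) *m y)
    = evalmx A (Some z) *m (evalmx B (Some z) *m y).
  apply/trmx_inj/row_matrixP => i; rewrite !rowE; apply: trmx_inj.
  rewrite !trmx_mul !trmxK mulmxBl -!mulmxA -E addrK.
  by [].
apply/colP => i.
have dB : is_derive (0 : Cx R) 1
    (fun s => (evalmx B (Some (z + s * 1)) *m
               (y + s *: (evalmx A (Some z) *m y))) i 0 : Cx R)
    ((ddxmx B z *m y + evalmx B (Some z) *m (evalmx A (Some z) *m y)) i 0).
  have -> : evalmx B (Some z) = evalmx B (Some (z + 0 * 1)) by rewrite mul0r addr0.
  apply: is_derive_mulmx => j.
  have -> : (fun s : Cx R => evalmx B (Some (z + s * 1)) i j) =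
      (fun s => fin (B i j (Some (z + s)))).
    by apply/funext => s; rewrite mxE mulr1.
  by rewrite mxE; apply: is_derive_ddx Uz (Bz i j); exact: Kmer.
have dA : is_derive (0 : Cx R) 1
    (fun s => (evalmx A (Some (z + s * 0)) *m
               (y + s *: (evalmx B (Some z) *m y))) i 0 : Cx R)
    ((0 *m y + evalmx A (Some z) *m (evalmx B (Some z) *m y)) i 0).
  have -> : evalmx A (Some z) = evalmx A (Some (z + 0 * 0)) by rewrite mul0r addr0.
  apply: is_derive_mulmx => j.
  have -> : (fun s : Cx R => evalmx A (Some (z + s * 0)) i j) =
      cst (evalmx A (Some z) i j).
    by apply/funext => s; rewrite mulr0 addr0.
  rewrite [X in is_derive _ _ _ X]mxE. exact: is_derive_cst.
have := congr1 (fun xi : Cx R * 'cV[Cx R]_n => xi.2 i 0) (bracket0 z y Uz Az Bz).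
rewrite /= [RHS]mxE [X in X = _]mxE /along /=. rewrite !derive1E => /eqP.
rewrite subr_eq0 => /eqP.
rewrite (@derive_val _ _ _ _ _ _ _ dB) (@derive_val _ _ _ _ _ _ _ dA).
by rewrite mul0mx add0r.
Qed.

Lemma sym1_rational_solution (R : realType) (U : set (CP1 R))
    (K : set (CP1 R -> CP1 R)) n (A B : 'M[CP1 R -> CP1 R]_n) :
  (forall f, K f -> meromorphic U f) -> sym1 U K A B ->
  rational_solution U K A (@Ad (Cx R) n) (mxvec B)^T.
Proof.
move=> Kmer symB; split.
  move=> p q; rewrite mxE ord1; case/mxvec_indexP: p => i j; rewrite mxvecE.
  by case: symB => KB _; exact: KB.
move=> z Uz Az vz.
have Bz : finite_at B (Some z).
  by move=> i j; have := vz (mxvec_index i j) 0; rewrite mxE mxvecE.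
rewrite /ddxmx /evalmx -!map_trmx !map_mxvec drep_Ad_mxvec.
by rewrite -[map_mx _ B]/(ddxmx B z) (sym1_ddxmx Kmer symB Uz Az Bz).
Qed.

Lemma Gal_comm (R : realType) (U : set (CP1 R))
    (K : set (CP1 R -> CP1 R)) n (A B : 'M[CP1 R -> CP1 R]_n) x0 s :
  (forall f, K f -> meromorphic U f) -> sym1 U K A B -> Gal U K A x0 s ->
  s *m evalmx B x0 = evalmx B x0 *m s.
Proof.
move=> Kmer symB [su /(_ _ _ (@alg_rep_Ad R n)) [fixsol _]].
have fixB := fixsol _ (sym1_rational_solution Kmer symB).
move: fixB; rewrite /evalmx -map_trmx map_mxvec Ad_mxvec.
move=> /trmx_inj /(can_inj mxvecK) /(congr1 (mulmx^~ s)).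
by rewrite mulmxKV.
Qed.

(** * Galoisian matrices form a group *)

Lemma Gal1 (R : realType) (U : set (CP1 R)) (K : set (CP1 R -> CP1 R)) n
    (A : 'M[CP1 R -> CP1 R]_n) x0 : Gal U K A x0 1%:M.
Proof.
split=> [|m Psi repPsi]; first exact: unitmx1.
rewrite (rep1 repPsi); split=> [v _|w _ _]; first by rewrite mul1mx.
by exists 1; rewrite mul1mx scale1r.
Qed.

Lemma GalM (R : realType) (U : set (CP1 R)) (K : set (CP1 R -> CP1 R)) n
    (A : 'M[CP1 R -> CP1 R]_n) x0 s t :
  Gal U K A x0 s -> Gal U K A x0 t -> Gal U K A x0 (s *m t).
Proof.
move=> [su Gs] [tu Gt]; split=> [|m Psi repPsi]; first by rewrite unitmx_mul su.
have [fs ls] := Gs _ _ repPsi; have [ft lt] := Gt _ _ repPsi.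
rewrite (repM repPsi su tu); split=> [v vsol|w wsol wx0].
  by rewrite -mulmxA ft // fs.
have [c tw] := lt _ wsol wx0; have [d sw] := ls _ wsol wx0.
by exists (c * d); rewrite -mulmxA tw -scalemxAr sw scalerA.
Qed.

Lemma GalV (R : realType) (U : set (CP1 R)) (K : set (CP1 R -> CP1 R)) n
    (A : 'M[CP1 R -> CP1 R]_n) x0 s :
  Gal U K A x0 s -> Gal U K A x0 (invmx s).
Proof.
move=> [su Gs]; split=> [|m Psi repPsi]; first by rewrite unitmx_inv.
have [fs ls] := Gs _ _ repPsi.
have PsiK : Psi (invmx s) *m Psi s = 1%:M.
  by rewrite -(repM repPsi) ?unitmx_inv // mulVmx // (rep1 repPsi).
split=> [v vsol|w wsol wx0].
  by rewrite -[in LHS](fs _ vsol) mulmxA PsiK mul1mx.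
have [c sw] := ls _ wsol wx0.
have wE : evalmx w x0 = c *: (Psi (invmx s) *m evalmx w x0).
  by rewrite scalemxAr -sw mulmxA PsiK mul1mx.
(* If c = 0, then w(x0) = 0 and any scalar will do. *)
have [c0|c0] := eqVneq c 0; last first.
  by exists c^-1; rewrite [in RHS]wE scalerA mulVf // scale1r.
by exists 0; rewrite wE c0 scale0r mulmx0 scaler0.
Qed.

(** * Triangularity of the Galois group *)

Theorem theorem6p13 (R : realType) (U : set (CP1 R))
    (U_nonempty : U !=set0) (U_open : open U) (U_connected : connected U)
    (K : set (CP1 R -> CP1 R)) (K_ff : function_field U K)
    (n : nat) (n_gt0 : (0 < n)%N)
    (A : 'M[CP1 R -> CP1 R]_n) (A_over_K : mx_over K A)
    (x0 : CP1 R) (U_x0 : U x0) (x0_nonsingular : nonsingular A x0) :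
  (exists2 B, sym1 U K A B & solver U A B) ->
  exists2 P : 'M[Cx R]_n, P \in unitmx &
    subgroup_of (@triangular_group R n) (conj_set P (Gal U K A x0)).
Proof.
move=> [B symB solverB].
have [P Pu Ptrig] := commutant_upper_trig (solverB _ U_x0 x0_nonsingular).
exists P => //; split.
- move=> _ [s Gs <-]; split.
    by case: Gs => su _; rewrite !unitmx_mul unitmx_inv Pu su.
  by apply: Ptrig; exact: Gal_comm (ff_meromorphic K_ff) symB Gs.
- by exists 1%:M; [exact: Gal1 | rewrite mulmx1 mulmxV].
- move=> _ _ [s Gs <-] [t Gt <-]; exists (s *m t); first exact: GalM.
  by rewrite !mulmxA mulmxKV.
- move=> _ [s Gs <-]; exists (invmx s); first exact: GalV.
  have su : s \in unitmx by case: Gs.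
  have PsPu : P *m s *m invmx P \in unitmx by rewrite !unitmx_mul unitmx_inv Pu su.
  apply: (can_inj (mulKmx PsPu)); rewrite mulmxV // !mulmxA mulmxKV //.
  by rewrite mulmxK // mulmxV.
Qed.
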